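(* If $m,n$ are integers with $3\leq m<n\leq (m-1)^2$, then $S(m)+S(n)\supseteq\left[0,\frac{1}{m-1}\right]$.
   Context: For $x\in[0,1]$, $a_n(x)$ is the $n$-th partial quotient of its regular continued fraction $x=[a_1,a_2,\ldots]=1/(a_1+1/(a_2+\cdots))$; rationals are written with last partial quotient at least $2$ (and $1=[1]$). For an integer $k\geq1$, $S(k)=\{x\in[0,1]: a_n(x)\geq k \text{ for all } n\}$, where a rational belongs to $S(k)$ if all its defined partial quotients are $\geq k$, and $0\in S(k)$. $S(m)+S(n)=\{c+b: c\in S(m), b\in S(n)\}$. *)

(* Defs.v *)
From HB Require Import structures.
From mathcomp Require Import all_boot all_order all_algebra.
From mathcomp Require Import all_classical all_reals all_analysis.
From mathcomp Require Import ring lra.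

Set Implicit Arguments.
Unset Strict Implicit.
Unset Printing Implicit Defensive.

Import Order.TTheory GRing.Theory Num.Theory.
Import numFieldNormedType.Exports.

Local Open Scope classical_set_scope.
Local Open Scope ring_scope.

(* Fractional part of 1/x; since 0^-1 = 0 here, gauss 0 = 0. *)
Definition gauss (R : realType) (x : R) : R := x^-1 - (Num.floor x^-1)%:~R.

(* The partial quotient a_n(x), n >= 1, given by the continued fraction
   algorithm; None when the expansion of x has fewer than n terms.  The lemmas
   below check that for x in [0, 1] this is the regular expansion of x, finite
   expansions being written with last term at least 2 (and 1 = [1]). *)
Definition partial_quotient (R : realType) (x : R) (n : nat) : option int :=
  let t := iter n.-1 (@gauss R) x in
  if t == 0 then None else Some (Num.floor t^-1).

Definition CFset (R : realType) (k : int) : set R :=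
  [set x | 0 <= x <= 1 /\
    forall (n : nat) (a : int),
      (0 < n)%N -> partial_quotient x n = Some a -> k <= a].

Arguments CFset R k : clear implicits.

Definition sumset (R : realType) (A B : set R) : set R :=
  [set c + b | c in A & b in B].

(* [a_1, ..., a_n] = 1 / (a_1 + 1 / (a_2 + ... + 1 / a_n)), the empty
   expansion being 0. *)
Definition cfrac (R : realType) (s : seq int) : R :=
  foldr (fun a y => (a%:~R + y)^-1) 0 s.

(* The defined ones among a_1(x), ..., a_n(x). *)
Definition partial_quotients (R : realType) (x : R) (n : nat) : seq int :=
  pmap (partial_quotient x) (iota 1 n).

Lemma gauss0 (R : realType) : gauss (0 : R) = 0.
Proof. by rewrite /gauss invr0 floor0 subrr. Qed.

Lemma gauss_itv (R : realType) (x : R) : 0 <= gauss x < 1.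
Proof.
have := floor_itv x^-1; rewrite /gauss intrD.
set f := (Num.floor _)%:~R; move=> /andP[h1 h2].
by apply/andP; split; lra.
Qed.

Lemma floor_inv_ge1 (R : realType) (x : R) :
  0 < x <= 1 -> 1 <= Num.floor x^-1.
Proof. by case/andP=> x0 x1; rewrite floor_ge_int invf_ge1. Qed.

Lemma iter_gauss_itv (R : realType) (x : R) (n : nat) :
  0 <= x <= 1 -> 0 <= iter n (@gauss R) x <= 1.
Proof.
case: n => [//|n] _; rewrite iterS.
by have /andP[-> /ltW ->] := gauss_itv (iter n (@gauss R) x).
Qed.

Lemma partial_quotient_ge1 (R : realType) (x : R) (n : nat) (a : int) :
  0 <= x <= 1 -> partial_quotient x n = Some a -> 1 <= a.
Proof.
move=> /(iter_gauss_itv n.-1); rewrite /partial_quotient.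
set t := iter _ _ _ => /andP[t0 t1]; case: eqP => // /eqP tn0 [<-].
by apply: floor_inv_ge1; rewrite lt0r tn0 t0 t1.
Qed.

Lemma last_partial_quotient_ge2 (R : realType) (x : R) (n : nat) (a : int) :
  (1 < n)%N -> partial_quotient x n = Some a ->
  partial_quotient x n.+1 = None -> 2 <= a.
Proof.
case: n => [//|[//|n]] _; rewrite /partial_quotient /=.
set t := gauss (iter n _ _); case: eqP => // /eqP tn0 [<-].
case: eqP => // gt0 _; have /andP[t0 t1] := gauss_itv (iter n (@gauss R) x).
have tp : 0 < t by rewrite lt0r tn0 t0.
have tE : t^-1 = (Num.floor t^-1)%:~R by apply/eqP; rewrite -subr_eq0; apply/eqP.
have : 1 < t^-1 by rewrite invf_gt1.
by rewrite [X in _ < X]tE ltr1z -lez1D.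
Qed.

Lemma partial_quotients0 (R : realType) (n : nat) :
  partial_quotients (0 : R) n = [::].
Proof.
rewrite /partial_quotients; elim: (iota 1 n) => //= k s ->.
rewrite /partial_quotient (_ : iter _ _ _ = 0) ?eqxx //.
by elim: (k.-1) => //= i ->; rewrite gauss0.
Qed.

Lemma partial_quotientsS (R : realType) (x : R) (n : nat) : x != 0 ->
  partial_quotients x n.+1 =
    Num.floor x^-1 :: partial_quotients (gauss x) n.
Proof.
move=> x0; rewrite /partial_quotients /=.
have -> : partial_quotient x 1 = Some (Num.floor x^-1).
  by rewrite /partial_quotient /= (negbTE x0).
congr cons.
suff H k : (0 < k)%N -> pmap (partial_quotient x) (iota k.+1 n) =
    pmap (partial_quotient (gauss x)) (iota k n) by exact: H.
elim: n k => //= n IHn k k0; rewrite IHn //; congr oapp.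
by case: k k0 => // k _; rewrite /partial_quotient /= -iterSr.
Qed.

Lemma dist_inv_le (R : realType) (a y z : R) (n : nat) :
  1 <= a -> 0 <= y -> 0 <= z -> `|y - z| <= n.+1%:R^-1 ->
  `|(a + y)^-1 - (a + z)^-1| <= n.+2%:R^-1.
Proof.
move=> a1 y0 z0 h.
have ay : 0 < a + y by lra.
have az : 0 < a + z by lra.
have -> : (a + y)^-1 - (a + z)^-1 = (z - y) / ((a + y) * (a + z)).
  by field; rewrite !gt_eqF.
rewrite normrM normfV [`|(a + y) * _|]gtr0_norm ?mulr_gt0 // distrC.
set d := `|y - z| in h *.
have d0 : 0 <= d by exact: normr_ge0.
have dle : d <= y + z.
  by rewrite /d ler_norml; apply/andP; split; lra.
have n1 : 0 < n.+1%:R :> R by rewrite ltr0n.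
have hd : d * n.+1%:R <= 1 by rewrite -ler_pdivlMr // mul1r.
have nE : n.+2%:R = n.+1%:R + 1 :> R by rewrite -natr1.
rewrite ler_pdivrMr ?mulr_gt0 // ler_pdivlMl ?ltr0n // nE.
have : 1 + d <= (a + y) * (a + z) by nra.
by lra.
Qed.

Lemma convergent_dist (R : realType) (n : nat) (x : R) : 0 <= x <= 1 ->
  0 <= cfrac R (partial_quotients x n) /\
  `|x - cfrac R (partial_quotients x n)| <= n.+1%:R^-1.
Proof.
elim: n x => [|n IHn] x x01.
  by case/andP: (x01) => x0 x1; rewrite /cfrac /= subr0 invr1 ger0_norm.
have [->|x0] := eqVneq x 0.
  by rewrite partial_quotients0 /cfrac /= subr0 normr0 invr_ge0 ler0n.
rewrite partial_quotientsS //=.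
have /andP[g0 g1] := gauss_itv x.
have [c0 cd] : _ /\ _ := IHn (gauss x) (introT andP (conj g0 (ltW g1))).
have a1 : 1 <= (Num.floor x^-1)%:~R :> R.
  by rewrite ler1z floor_inv_ge1 // lt0r x0.
set c := cfrac R _ in c0 cd *; split.
  by rewrite invr_ge0 addr_ge0 // (le_trans ler01).
have {1}-> : x = ((Num.floor x^-1)%:~R + gauss x)^-1.
  by rewrite /gauss addrC subrK invrK.
exact: dist_inv_le.
Qed.

Lemma cvg_partial_quotients (R : realType) (x : R) : 0 <= x <= 1 ->
  cfrac R (partial_quotients x n) @[n --> \oo] --> x.
Proof.
move=> x01; apply/subr_cvg0; apply/norm_cvg0P.
apply: (@squeeze_cvgr _ _ _ _ (fun=> 0) (@harmonic R)).
- by apply: nearW => n; rewrite normr_ge0 distrC; case: (convergent_dist n x01).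
- exact: cvg_cst.
- exact: cvg_harmonic.
Qed.

(* Main.v *)
(* Put p = m - 1.  It suffices to treat n = p ^ 2, and to solve x + y = t with x
   in S(p + 1) and y in S(p ^ 2) when 0 <= t <= 1/p.  Consider more generally
     alpha x y + beta x + gamma y = delta,  alpha delta + beta gamma = 1.
   Substituting x = 1/(a + x'), y = 1/(b + y') gives a relation of the same kind,
   with the same normalization, where
     alpha' = delta, beta' = delta b - gamma, gamma' = delta a - beta,
     delta delta' = 1 - beta' gamma'.
   Choose a minimal with gamma' > 0, so that gamma' <= delta, then b maximal with
   beta' gamma' <= 1, so that (beta' + delta) gamma' > 1.  Then
   0 <= delta' < gamma' <= delta, and the bounds delta <= 1/p and p delta <= beta
   persist; they force a >= p + 1 and b >= (1 / gamma') / delta >= p ^ 2.  Iterating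
   until delta = 0, or forever, produces the expansions of x and y. *)
Require Import Defs.
From mathcomp Require Import all_boot all_order all_algebra.
From mathcomp Require Import all_classical all_reals all_analysis.
From mathcomp Require Import zify ring lra.

Import Order.TTheory GRing.Theory Num.Theory.
Local Open Scope classical_set_scope.
Local Open Scope ring_scope.

(** * A vanishing criterion, and coinduction for [CFset] *)

Lemma eq0_of_norm_le_harmonic (R : realType) (x C : R) :
  (forall n : nat, `|x| <= C / n.+1%:R) -> x = 0.
Proof.
move=> xC; apply/eqP; rewrite -normr_le0 leNgt; apply/negP => x0.
have /archi_boundP : 0 <= C / `|x|.
  have := xC 0; rewrite divr1 => C0.
  by rewrite divr_ge0 // (le_trans _ C0).
set N := Num.bound _; rewrite ltr_pdivrMr // => CN.
have := xC N; rewrite ler_pdivlMr ?ltr0n // -natr1; nra.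
Qed.

(** As [k >= 2], all elements of [A] are below 1, so in [x = 1 / (a + y)] the integer [a] is the
    floor of [1 / x] and [y] is [gauss x]: the Gauss orbit stays in [A] until it reaches 0. *)
Lemma CFset_coind (R : realType) (k : int) (A : set R) : 2 <= k ->
  (forall x, A x -> 0 <= x /\
     (x = 0 \/ exists a y, [/\ k <= a, A y & x = (a%:~R + y)^-1])) ->
  A `<=` CFset R k.
Proof.
move=> k2 HA.
have k2R (a : int) : k <= a -> 2 <= a%:~R :> R.
  by move=> ka; rewrite (ler_int R 2 a) (le_trans k2).
have A1 x : A x -> x < 1.
  case/HA=> _ [->|[a [y [/k2R a2 /HA[y0 _] ->]]]]; first exact: ltr01.
  by rewrite invf_lt1; lra.
have Agauss x : A x -> x = 0 \/
    exists a, [/\ k <= a, A (gauss x) & Num.floor x^-1 = a].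
  case/HA=> _ [->|[a [y [ka Ay ->]]]]; [by left | right].
  have [y0 _] := HA _ Ay.
  have fl : Num.floor (a%:~R + y) = a.
    by apply: floor_def; rewrite intrD; have := A1 _ Ay; lra.
  by exists a; rewrite /gauss invrK fl (addrC _ y) addrK.
have Aiter x i : A x -> iter i (@gauss R) x = 0 \/ A (iter i (@gauss R) x).
  move=> Ax; elim: i => [|i IHi] /=; first by right.
  case: IHi => [->|/Agauss[->|[a [_ ? _]]]]; rewrite ?gauss0; by [left|right].
move=> x Ax; split.
  by have [x0 _] := HA _ Ax; rewrite x0 ltW // A1.
move=> n a _; rewrite /partial_quotient; case: eqP => // xn0 [<-].
by case: (Aiter x n.-1 Ax) => // /Agauss[//|[b [kb _ ->]]].
Qed.

(** * Continued fractions with digits read along an orbit *)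

Section ContinuedFractionOfOrbit.
Variables (R : realType) (T : Type) (P : T -> Prop).
Variables (stop : pred T) (digit : T -> int) (next : T -> T).
Hypothesis P_next : forall s, P s -> ~~ stop s -> 1 <= digit s /\ P (next s).

Fixpoint truncation (n : nat) (s : T) : R :=
  if n isn't n'.+1 then 0 else
  if stop s then 0 else ((digit s)%:~R + truncation n' (next s))^-1.

Lemma truncation_itv n s : P s -> 0 <= truncation n s <= 1.
Proof.
elim: n s => [|n IHn] s Ps /=; first by rewrite lexx ler01.
case: ifPn => [_|/(P_next _ Ps)[d1 /IHn/andP[t0 _]]]; first by rewrite lexx ler01.
have d1R : 1 <= (digit s)%:~R :> R by rewrite ler1z.
by rewrite invr_ge0 invf_le1; lra.
Qed.

(** Two truncations lie at distance at most 1 in [[0, 1]], and by [dist_inv_le] each common digit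
    improves [1 / i] to [1 / (i + 1)]. *)
Lemma truncation_dist n k s : P s ->
  `|truncation n s - truncation (n + k) s| <= n.+1%:R^-1.
Proof.
elim: n s => [|n IHn] s Ps.
  by have /andP[? ?] := truncation_itv k s Ps; rewrite /= sub0r normrN invr1 ger0_norm.
rewrite addSn /=; case: ifPn => [_|/(P_next _ Ps)[d1 Pn]].
  by rewrite subrr normr0 invr_ge0 ler0n.
apply: dist_inv_le; rewrite ?ler1z //; last exact: IHn.
- by case/andP: (truncation_itv n _ Pn).
- by case/andP: (truncation_itv (n + k) _ Pn).
Qed.

(* The supremum of the lower bounds that [truncation_dist] gives for the limit. *)
Definition cf_value (s : T) : R :=
  sup (range (fun n => truncation n s - n.+1%:R^-1)).

Lemma cf_value_dist n s : P s -> `|cf_value s - truncation n s| <= n.+1%:R^-1.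
Proof.
move=> Ps; pose w (i : nat) : R := i.+1%:R^-1; rewrite -/(w n).
have w0 i : 0 <= w i by rewrite invr_ge0 ler0n.
have wdist i k : (i <= k)%N -> `|truncation i s - truncation k s| <= w i.
  by move=> ik; rewrite -[in X in `|_ - X|](subnKC ik) truncation_dist.
have ub k :
  ubound (range (fun n => truncation n s - w n)) (truncation k s + w k).
  move=> _ [i _ <-] /=; have := w0 i; have := w0 k; rewrite lerBlDr.
  by case: (leqP i k) => [/wdist|/ltnW/wdist]; rewrite ler_norml => /andP[]; lra.
have le1 : truncation n s - w n <= cf_value s.
  by apply: ub_le_sup; [exists (truncation 0 s + w 0%N); exact: ub | exists n].
have le2 : cf_value s <= truncation n s + w n.
  by apply: ge_sup; [exists (truncation 0 s - w 0%N); exists 0%N | exact: ub].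
by rewrite ler_norml; apply/andP; split; lra.
Qed.

Lemma cf_value_itv s : P s -> 0 <= cf_value s <= 1.
Proof.
move=> Ps.
have small (e : R) : 0 < e -> exists n, `|cf_value s - truncation n s| < e.
  move=> e0; exists (Num.bound e^-1); apply: le_lt_trans (cf_value_dist _ _ Ps) _.
  rewrite invf_plt ?posrE ?ltr0n //.
  by rewrite -natr1 (lt_trans (archi_boundP _)) ?invr_ge0 ?ltW // ltrDl.
apply/andP; split; rewrite leNgt; apply/negP => h.
  have [|n] := small (- cf_value s); first by lra.
  by have /andP[? ?] := truncation_itv n s Ps; rewrite ltr_norml => /andP[]; lra.
have [|n] := small (cf_value s - 1); first by lra.
by have /andP[? ?] := truncation_itv n s Ps; rewrite ltr_norml => /andP[]; lra.
Qed.

Lemma cf_valueE s : P s -> cf_value s =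
  if stop s then 0 else ((digit s)%:~R + cf_value (next s))^-1.
Proof.
move=> Ps; apply/eqP; rewrite -subr_eq0; apply/eqP.
(* The 2 adds two errors: each side is within [1 / (n + 2)] of [truncation n.+1 s]. *)
apply: (@eq0_of_norm_le_harmonic _ _ 2) => n.
have := cf_value_dist n.+1 s Ps => /=.
set g := if _ then 0 else (_ + cf_value _)^-1; set h := if _ then _ else _.
have hg : `|h - g| <= n.+2%:R^-1.
  rewrite /h /g; case: ifPn => [_|/(P_next _ Ps)[d1 Pn]].
    by rewrite subrr normr0 invr_ge0 ler0n.
  apply: dist_inv_le; rewrite ?ler1z // 1?distrC; last exact: cf_value_dist.
  - by case/andP: (truncation_itv n _ Pn).
  - by case/andP: (cf_value_itv _ Pn).
have : n.+2%:R^-1 <= n.+1%:R^-1 :> R by rewrite lef_pV2 ?posrE ?ltr0n // ler_nat.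
move: hg; move: (n.+2%:R^-1) (n.+1%:R^-1) => w2 w1.
rewrite !ler_norml => /andP[? ?] ? /andP[? ?].
by apply/andP; split; lra.
Qed.

End ContinuedFractionOfOrbit.

(* The relation [cxy * x * y + cx * x + cy * y = c0]. *)
Record bilin (R : realType) := Bilin { cxy : R; cx : R; cy : R; c0 : R }.
Arguments Bilin {R} _ _ _ _.
Arguments cxy {R} _.
Arguments cx {R} _.
Arguments cy {R} _.
Arguments c0 {R} _.

(** * The digit algorithm on bilinear relations *)

Section Expansion.
Variables (R : realType) (p : int).
Hypothesis p2 : 2 <= p.

Implicit Types s : bilin R.

(** The invariant of the iteration; [cxy], [cx], [cy], [c0] are alpha, beta, gamma, delta. *)
Definition admissible s :=
  [/\ 0 <= c0 s <= p%:~R^-1, 0 <= cxy s <= p%:~R^-1,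
      p%:~R * c0 s <= cx s, 0 <= cy s &
      cxy s * c0 s + cx s * cy s = 1].

(** For [c0 s > 0], taking floor plus 1 rather than a ceiling keeps the next [cy] strictly positive,
    as [ydigit] inverts it. *)
Definition xdigit s : int := Num.floor (cx s / c0 s) + 1.

(* The largest b such that the next relation has [cx * cy <= 1]. *)
Definition ydigit s : int :=
  Num.floor (((c0 s * (xdigit s)%:~R - cx s)^-1 + cy s) / c0 s).

Definition bnext s :=
  let a := (xdigit s)%:~R in let b := (ydigit s)%:~R in
  Bilin (c0 s) (c0 s * b - cy s) (c0 s * a - cx s)
    (cxy s + cx s * b + cy s * a - c0 s * a * b).

Lemma bnext_admissible s : admissible s -> c0 s != 0 ->
  [/\ p + 1 <= xdigit s, p ^+ 2 <= ydigit s & admissible (bnext s)] /\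
  [/\ cy (bnext s) <= c0 s & c0 (bnext s) <= c0 s].
Proof.
case: s => al be ga de [/= /andP[de0 dep] /andP[al0 alp] pde ga0 D dn0].
have P2 : 2 <= p%:~R :> R by rewrite (ler_int R 2 p).
have {de0 dn0} de0 : 0 < de by rewrite lt0r dn0.
have hdep : de * p%:~R <= 1 by rewrite -ler_pdivlMr ?mul1r //; lra.
set s := Bilin _ _ _ _.
have /andP[a1] := floor_itv (be / de); rewrite [X in _ < X -> _]intrD => a2.
have aE : (xdigit s)%:~R = (Num.floor (be / de))%:~R + 1 :> R by rewrite intrD.
have pa : p + 1 <= xdigit s.
  by rewrite lerD2r floor_ge_int ler_pdivlMr.
move: a1 a2; rewrite ler_pdivlMr // ltr_pdivrMr // => a1 a2.
set a := (xdigit s)%:~R in aE *.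
(* From here on [u], [v], [d] stand for gamma', beta', delta'. *)
set u := de * a - be.
have u0 : 0 < u by rewrite /u aE; lra.
have ud : u <= de by rewrite /u aE; lra.
have /andP[b1] := floor_itv ((u^-1 + ga) / de).
rewrite [X in _ < X -> _]intrD -[Num.floor _]/(ydigit s) in b1 *.
move: b1; rewrite ler_pdivlMr // ltr_pdivrMr // => b1 b2.
have pb : p ^+ 2 <= ydigit s.
  rewrite floor_ge_int ler_pdivlMr // -[de * a - be]/u.
  have : de^-1 <= u^-1 by rewrite lef_pV2.
  have : p%:~R ^+ 2 * de <= de^-1.
    rewrite -(ler_pM2r de0) mulVf ?gt_eqF // -mulrA -expr2 -exprMn mulrC.
    by rewrite expr_le1 // mulr_ge0 //; lra.
  by rewrite rmorphXn /=; lra.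
set b := (ydigit s)%:~R in b1 b2 *.
set v := de * b - ga.
have vu1 : v * u <= 1 by rewrite -ler_pdivlMr // mul1r /v; lra.
have vu2 : 1 < (v + de) * u by rewrite -ltr_pdivrMr // mul1r /v; lra.
(* The normalization [D] turns the bounds on [v * u] into bounds on [d]. *)
have dE : de * (al + be * b + ga * a - de * a * b) = 1 - v * u.
  by rewrite /u /v -D; ring.
rewrite /admissible /bnext /= -/a -/b -/u -/v.
set d := al + be * b + ga * a - de * a * b in dE *.
have d0 : 0 <= d by rewrite -(pmulr_rge0 _ de0) dE; lra.
have du : d <= u by rewrite -(ler_pM2l de0) dE; lra.
(* Aim: [p * d <= v]. Indeed [v > 1 / u - de >= p - 1 / 2 > 1 >= p * d]. *)
have uV : u^-1 - de < v.
  by rewrite -(ltr_pM2r u0) mulrBl mulVf ?gt_eqF //; lra.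
have pu : p%:~R <= u^-1.
  rewrite -(ler_pM2r u0) mulVf ?gt_eqF // (le_trans _ hdep) // mulrC ler_wpM2r //; lra.
have de12 : de <= 2^-1 by nra.
have pd : p%:~R * d <= 1.
  by rewrite (le_trans _ hdep) // mulrC ler_wpM2r ?(le_trans du) //; lra.
have pv : p%:~R * d <= v by move: (u^-1) pu uV => w pu uV; lra.
have dp : d <= p%:~R^-1 by rewrite (le_trans du) // (le_trans ud).
have uv1 : de * d + v * u = 1 by rewrite dE subrK.
split; last by split; [exact: ud | exact: le_trans du ud].
split; [exact: pa | exact: pb | split; [| | exact: pv | exact: ltW | exact: uv1]].
  by apply/andP; split; [exact: d0 | exact: dp].
by apply/andP; split; [exact: ltW | exact: dep].
Qed.

(** * The two numbers expanded by the algorithm *)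

Definition terminal s := c0 s == 0.

Definition xvalue : bilin R -> R := cf_value R _ terminal xdigit bnext.
Definition yvalue : bilin R -> R := cf_value R _ terminal ydigit bnext.

Lemma xdigit_bnext s : admissible s -> ~~ terminal s ->
  1 <= xdigit s /\ admissible (bnext s).
Proof. by move=> As /(bnext_admissible _ As)[[? ? ?] _]; split=> //; lia. Qed.

Lemma ydigit_bnext s : admissible s -> ~~ terminal s ->
  1 <= ydigit s /\ admissible (bnext s).
Proof. by move=> As /(bnext_admissible _ As)[[? ? ?] _]; split=> //; nia. Qed.

Lemma xvalueE s : admissible s -> xvalue s =
  if terminal s then 0 else ((xdigit s)%:~R + xvalue (bnext s))^-1.
Proof. exact: cf_valueE xdigit_bnext s. Qed.

Lemma yvalueE s : admissible s -> yvalue s =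
  if terminal s then 0 else ((ydigit s)%:~R + yvalue (bnext s))^-1.
Proof. exact: cf_valueE ydigit_bnext s. Qed.

Lemma xvalue_itv s : admissible s -> 0 <= xvalue s <= 1.
Proof. exact: cf_value_itv xdigit_bnext s. Qed.

Lemma yvalue_itv s : admissible s -> 0 <= yvalue s <= 1.
Proof. exact: cf_value_itv ydigit_bnext s. Qed.

(** * The two values satisfy the relation *)

Definition defect s :=
  cxy s * xvalue s * yvalue s + cx s * xvalue s + cy s * yvalue s - c0 s.

(** Clearing the denominators of [x = 1 / (a + x')] and [y = 1 / (b + y')] takes out a factor
    [x * y]; the sign appears because [bnext] moves all terms across the equation. *)
Lemma defect_next s : admissible s -> ~~ terminal s ->
  defect s = - (xvalue s * yvalue s * defect (bnext s)).
Proof.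
move=> As nt; have [[a1 b1 An] _] := bnext_admissible _ As nt.
rewrite /defect xvalueE // yvalueE // (negbTE nt).
have /andP[x0 _] := xvalue_itv _ An; have /andP[y0 _] := yvalue_itv _ An.
move: (xvalue _) (yvalue _) x0 y0 => x y x0 y0.
rewrite /bnext /=.
have : 0 < (xdigit s)%:~R :> R by rewrite ltr0z; lia.
have : 0 < (ydigit s)%:~R :> R by rewrite ltr0z; nia.
move: (_%:~R) (_%:~R) => b a b0 a0.
by field; rewrite !gt_eqF //; lra.
Qed.

Lemma xyvalue_le s : admissible s -> ~~ terminal s ->
  xvalue s <= 2^-1 /\ yvalue s * (ydigit s)%:~R <= 1.
Proof.
move=> As nt; have [[a1 b1 An] _] := bnext_admissible _ As nt.
rewrite xvalueE // yvalueE // (negbTE nt).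
have /andP[x0 _] := xvalue_itv _ An; have /andP[y0 _] := yvalue_itv _ An.
have a2 : 2 <= (xdigit s)%:~R :> R by rewrite (ler_int R 2); lia.
have b2 : 1 <= (ydigit s)%:~R :> R by rewrite ler1z; nia.
split; first by rewrite lef_pV2 ?posrE; lra.
by rewrite mulrC ler_pdivrMr ?mul1r; lra.
Qed.

(* [cx (bnext s)] is unbounded, but it is at most [c0 s * ydigit s], and
   [yvalue s] is at most [1 / ydigit s]. *)
Lemma defect_bound s : admissible s -> `|defect s| <= 2.
Proof.
move=> As; case: (boolP (terminal s)) => [ts|nt].
  rewrite /defect xvalueE // yvalueE // ts !mulr0 !addr0 (eqP ts) subrr normr0.
  by lra.
have [[a1 b1 An] [hg hd]] := bnext_admissible _ As nt.
have [xle yle] := xyvalue_le _ As nt.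
have /andP[x0 _] := xvalue_itv _ As; have /andP[y0 y1] := yvalue_itv _ As.
have P2 : 2 <= p%:~R :> R by rewrite (ler_int R 2 p).
have pV : p%:~R^-1 <= 2^-1 :> R by rewrite lef_pV2 ?posrE; lra.
rewrite defect_next // normrN normrM ger0_norm ?mulr_ge0 //.
have [/andP[c0_ge0 c0_le] _ _ cy0 _] := As.
have [/andP[c'0 _] _ pc' cy'0 _] := An.
have /andP[x'0 x'1] := xvalue_itv _ An; have /andP[y'0 y'1] := yvalue_itv _ An.
have cx'0 : 0 <= cx (bnext s) by apply: le_trans pc'; rewrite mulr_ge0 //; lra.
have ycx : yvalue s * cx (bnext s) <= 2^-1.
  apply: le_trans (_ : c0 s * (yvalue s * (ydigit s)%:~R) <= _); last by nra.
  by rewrite mulrCA ler_wpM2l //= gerBl.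
(* The 1 covers the [cxy] and [cy] terms, each at most [c0 s <= 1 / 2]; the subtracted [c0] is also
   at most [1 / 2]. *)
have d' : `|defect (bnext s)| <= 1 + cx (bnext s).
  rewrite /defect.
  move: (xvalue _) (yvalue _) x'0 x'1 y'0 y'1 => x y x0' x1' y0' y1'.
  have h1 : cxy (bnext s) * x * y <= 2^-1.
    rewrite -mulrA; apply: le_trans (_ : c0 s * 1 <= _); last by lra.
    by rewrite ler_wpM2l //; nra.
  have h1' : 0 <= cxy (bnext s) * x * y by rewrite !mulr_ge0.
  have h2 : cx (bnext s) * x <= cx (bnext s) by rewrite ler_piMr.
  have h2' : 0 <= cx (bnext s) * x by rewrite mulr_ge0.
  have h3 : cy (bnext s) * y <= cy (bnext s) by rewrite ler_piMr.
  have h3' : 0 <= cy (bnext s) * y by rewrite mulr_ge0.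
  by rewrite ler_norml; apply/andP; split; lra.
apply: le_trans (_ : 1 * (yvalue s * (1 + cx (bnext s))) <= _); last by lra.
rewrite -mulrA; apply: ler_pM; [by []|by rewrite mulr_ge0|by lra|].
by rewrite ler_wpM2l.
Qed.

(** The bound 2 is uniform over admissible relations, and [x * y <= 1 / 2] halves it at each step.
    The weaker rate [2 / (n + 1)] suffices, since half of it is at most [2 / (n + 2)]. *)
Lemma defect0 s : admissible s -> defect s = 0.
Proof.
move=> As; apply: (eq0_of_norm_le_harmonic _ _ 2) => n.
elim: n s As => [|n IHn] s As; first by rewrite divr1 defect_bound.
have n0 : 0 < n.+2%:R :> R by rewrite ltr0n.
case: (boolP (terminal s)) => [ts|nt].
  rewrite /defect xvalueE // yvalueE // ts !mulr0 !addr0 (eqP ts) subrr normr0.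
  by rewrite divr_ge0 // ltW.
have [[a1 b1 An] _] := bnext_admissible _ As nt.
have [xle _] := xyvalue_le _ As nt.
have /andP[x0 _] := xvalue_itv _ As; have /andP[y0 y1] := yvalue_itv _ As.
rewrite defect_next // normrN normrM ger0_norm ?mulr_ge0 //.
have := IHn _ An; rewrite ler_pdivlMr ?ltr0n // ler_pdivlMr // -!natr1.
set E := `|_|; have E0 : 0 <= E by exact: normr_ge0.
have : 0 <= n%:R :> R by rewrite ler0n.
move: (n%:R) (xvalue s) (yvalue s) x0 xle y0 y1 => w x y x0 xle y0 y1 w0 h.
have xy : x * y <= 2^-1 by nra.
have : x * y * E * (w + 1 + 1) <= 2^-1 * (E * (w + 1 + 1)).
  by rewrite -mulrA ler_wpM2r // mulr_ge0 //; lra.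
nra.
Qed.

(** * Digit bounds of the two values, and the sumset *)

Lemma xvalue_CFset s : admissible s -> CFset R (p + 1) (xvalue s).
Proof.
move=> As; apply: (CFset_coind _ _ (xvalue @` admissible)); [by lia| |by exists s].
move=> _ [r Ar <-]; split; first by case/andP: (xvalue_itv _ Ar).
rewrite xvalueE //; case: ifPn => [_|nt]; [by left|right].
have [[? _ An] _] := bnext_admissible _ Ar nt.
by exists (xdigit r), (xvalue (bnext r)); split=> //; exists (bnext r).
Qed.

Lemma yvalue_CFset s : admissible s -> CFset R (p ^+ 2) (yvalue s).
Proof.
move=> As; apply: (CFset_coind _ _ (yvalue @` admissible)); [by nia| |by exists s].
move=> _ [r Ar <-]; split; first by case/andP: (yvalue_itv _ Ar).
rewrite yvalueE //; case: ifPn => [_|nt]; [by left|right].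
have [[_ ? An] _] := bnext_admissible _ Ar nt.
by exists (ydigit r), (yvalue (bnext r)); split=> //; exists (bnext r).
Qed.

End Expansion.

Lemma CFset_le (R : realType) (k l : int) : k <= l -> CFset R l `<=` CFset R k.
Proof.
move=> kl x [x01 H]; split=> // n a n0 /(H n a n0); exact: le_trans.
Qed.

Theorem theorem3 (R : realType) (m n : int) :
  3 <= m -> m < n -> n <= (m - 1) ^+ 2 ->
  `[0, 1 / (m%:~R - 1)]%classic `<=` sumset (CFset R m) (CFset R n).
Proof.
move=> m3 mn nm t /=; rewrite in_itv /= => /andP[t0 t1].
have p2 : 2 <= m - 1 by lia.
(* This encodes [x + y = t]; with [p = m - 1], the condition [p * c0 <= cx] is
   [t <= 1 / (m - 1)]. *)
pose s := Bilin 0 1 1 t.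
have P2 : 2 <= (m - 1)%:~R :> R by rewrite (ler_int R 2).
have As : admissible R (m - 1) s.
  have tp : t <= (m - 1)%:~R^-1 by rewrite intrD -div1r.
  rewrite /admissible /= t0 tp lexx invr_ge0 mul0r mul1r add0r.
  split=> //; first by lra.
  by rewrite mulrC -ler_pdivlMr ?mul1r //; lra.
exists (xvalue R s).
  by have := xvalue_CFset _ _ p2 _ As; rewrite subrK.
exists (yvalue R s).
  by apply: (CFset_le _ _ _ nm); exact: yvalue_CFset.
have := defect0 _ _ p2 _ As; rewrite /defect /= !mul0r !mul1r add0r.
by move/eqP; rewrite subr_eq0 => /eqP.
Qed.
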